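(* Let $\mathbb A=\mathbb R1_{\mathbb A}\oplus\mathfrak m$ be a Weil algebra of nilpotency index $N$ and let $U\subset\mathbb R$ be an open interval. Suppose that $F\in C^{N+1}(U^{\mathbb A},\mathbb A)$ is $\mathbb A$-holomorphic and that its restriction to the real axis is scalar-valued, i.e. there is a function $f:U\to\mathbb R$ with $$F(x)=f(x)1_{\mathbb A},\qquad x\in U.$$ Then $f\in C^{N+1}(U,\mathbb R)$, and for all $x\in U$ and $H\in\mathfrak m$, $$F(x+H)=\sum_{k=0}^{N}\frac{f^{(k)}(x)}{k!}H^k=(J_{\mathbb A}f)(x+H).$$ Consequently, two $C^{N+1}$, $\mathbb A$-holomorphic maps $U^{\mathbb A}\to\mathbb A$ with the same scalar-valued restriction to $U$ coincide.
   Context: A Weil algebra is a finite-dimensional, commutative, associative real algebra with unit of the form $\mathbb A=\mathbb R 1_{\mathbb A}\oplus\mathfrak m$, where $\mathfrak m$ is the unique maximal ideal and $\mathfrak m^{N+1}=0$, $\mathfrak m^N\neq 0$; $N$ is its nilpotency index. The scalar-part projection $\pi:\mathbb A\to\mathbb R$ is the algebra morphism with kernel $\mathfrak m$. $\mathbb A$ is identified with its underlying finite-dimensional real vector space, and real $x$ is identified with $x1_{\mathbb A}$. For $U\subset\mathbb R$ open, $U^{\mathbb A}=\{Z\in\mathbb A:\pi(Z)\in U\}=U+\mathfrak m$. Finite Weil prolongation (one variable): for $f\in C^N(U,\mathbb R)$, $x\in U$, $H\in\mathfrak m$, $(J_{\mathbb A}f)(x+H)=\sum_{k=0}^N\frac{1}{k!}f^{(k)}(x)H^k\in\mathbb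 A$. A map $F\in C^1(U^{\mathbb A},\mathbb A)$ is $\mathbb A$-holomorphic if its real Fréchet differential $\mathrm D_RF(Z)$ is $\mathbb A$-linear at every point $Z\in U^{\mathbb A}$; equivalently, there is a (unique) map $F':U^{\mathbb A}\to\mathbb A$ with $\mathrm D_RF(Z)[K]=F'(Z)K$ for all $K\in\mathbb A$, namely $F'(Z)=\mathrm D_RF(Z)[1_{\mathbb A}]$. Here $C^r$ regularity is in the sense of real vector spaces. *)

(* Defs.v *)
From HB Require Import structures.
From mathcomp Require Import all_boot all_order all_algebra falgebra.
From mathcomp Require Import all_classical all_reals all_analysis.

Set Implicit Arguments.
Unset Strict Implicit.
Unset Printing Implicit Defensive.

Import Order.TTheory GRing.Theory Num.Theory.
Import VectorInternalTheory.
Import numFieldNormedType.Exports.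

Local Open Scope classical_set_scope.
Local Open Scope ring_scope.

#[short(type="comFalgType")]
HB.structure Definition ComFalgebra (R : nzRingType) :=
  {A of Falgebra R A & GRing.ComNzRing A}.

Section WeilAlgebra.
Context {R : realType} {A : comFalgType R}.
Implicit Types (m I J : {vspace A}) (N : nat).

(* Ideals of a unital algebra are automatically linear subspaces. *)
Definition is_ideal I : Prop := ({:A} * I <= I)%VS.

Definition is_maximal_ideal I : Prop :=
  [/\ is_ideal I, I <> {:A}%VS &
      forall J, is_ideal J -> (I <= J)%VS -> J = I \/ J = {:A}%VS].

(* A = R 1 (+) m with m the unique maximal ideal, and N the nilpotency index.
   [1%VS] is the line R 1 and [(m ^+ n)%VS] is the span of n-fold products. *)
Record is_weil_algebra m N : Prop := IsWeilAlgebra {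
  weil_sum : (1 + m)%VS = {:A}%VS ;
  weil_direct : directv (1 + m) ;
  weil_maximal : is_maximal_ideal m ;
  weil_unique : forall J, is_maximal_ideal J -> J = m ;
  weil_nilpotent : (m ^+ N.+1)%VS = 0%VS ;
  weil_index : (m ^+ N)%VS <> 0%VS
}.

(* The coefficient on 1 of the projection onto R 1 parallel to m. *)
Definition scalar_part m (Z : A) : R :=
  coord [tuple (1 : A)] ord0 (daddv_pi 1%VS m Z).

Lemma scalar_partD m N (x : R) (H : A) : is_weil_algebra m N -> H \in m ->
  scalar_part m (x%:A + H) = x.
Proof.
move=> wA Hm; have /directv_addP cap0 := weil_direct wA.
have fr : free [tuple (1 : A)] by rewrite /= seq1_free oner_neq0.
have x1 : x%:A \in (1%VS : {vspace A}) by rewrite rpredZ ?rpred1 ?memv_line.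
rewrite /scalar_part linearD /= daddv_pi_id // (_ : daddv_pi 1 m H = 0).
  rewrite addr0 linearZ /= -[1 in X in _ * X]/([tuple (1 : A)]`_(@ord0 0)).
  by rewrite coord_free // eqxx mulr1.
have capm : (m :&: 1 = 0)%VS by rewrite capvC.
have := daddv_pi_add cap0 (_ : H \in (1 + m)%VS).
rewrite (daddv_pi_id capm Hm) => /(_ (subvP (addvSr _ _) _ Hm)).
by rewrite -[RHS]add0r => /addIr.
Qed.

Lemma scalar_part_decomp m N (Z : A) : is_weil_algebra m N ->
  Z - (scalar_part m Z)%:A \in m.
Proof.
move=> wA; have : Z \in (1 + m)%VS by rewrite (weil_sum wA) memvf.
case/memv_addP => u /vlineP[x ->] [H Hm ->].
by rewrite (scalar_partD x wA Hm) addrC addKr.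
Qed.

Lemma scalar_part_ker m N (Z : A) : is_weil_algebra m N ->
  (scalar_part m Z == 0) = (Z \in m).
Proof.
move=> wA; apply/eqP/idP => [Z0|Zm].
  by have := scalar_part_decomp Z wA; rewrite Z0 scale0r subr0.
by rewrite -[Z]add0r -[0 in LHS](scale0r (1 : A)) (scalar_partD _ wA).
Qed.

Lemma scalar_part1 m N : is_weil_algebra m N -> scalar_part m (1 : A) = 1.
Proof.
by move=> wA; rewrite -[1 in LHS]scale1r -[_ *: _]addr0 (scalar_partD _ wA) ?mem0v.
Qed.

Lemma scalar_part_linear m (a : R) (Y Z : A) :
  scalar_part m (a *: Y + Z) = a * scalar_part m Y + scalar_part m Z.
Proof. by rewrite /scalar_part !linearP. Qed.

Lemma scalar_partM m N (Y Z : A) : is_weil_algebra m N ->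
  scalar_part m (Y * Z) = scalar_part m Y * scalar_part m Z.
Proof.
move=> wA; case: (weil_maximal wA) => mI _ _.
have mM (a b : A) : b \in m -> a * b \in m.
  by move=> bm; apply: (subvP mI); apply: memv_mul => //; exact: memvf.
set y := scalar_part m Y; set z := scalar_part m Z.
have Ym := scalar_part_decomp Y wA; have Zm := scalar_part_decomp Z wA.
rewrite -/y -/z in Ym Zm.
have -> : Y * Z = (y * z)%:A + (Y * (Z - z%:A) + z%:A * (Y - y%:A)).
  rewrite !mulrBr -!scalerAl -!scalerAr mulr1 !mul1r scalerA (mulrC z y).
  by rewrite [X in _ + X]addrA subrK addrCA subrr addr0.
by rewrite (scalar_partD _ wA) // memvD // mM.
Qed.

Definition weil_domain m (U : set R) : set A := scalar_part m @^-1` U.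

Lemma weil_domainE m N (U : set R) : is_weil_algebra m N ->
  weil_domain m U = [set Z | exists2 x, U x & exists2 H, H \in m & Z = x%:A + H].
Proof.
move=> wA; apply/seteqP; split=> Z /=.
  move=> UZ; exists (scalar_part m Z) => //.
  exists (Z - (scalar_part m Z)%:A); first exact: scalar_part_decomp wA.
  by rewrite addrC subrK.
by case=> x Ux [H Hm ->]; rewrite /weil_domain /= (scalar_partD _ wA).
Qed.

(* J_A f; the argument is split as Z = x + H with x its scalar part. *)
Definition weil_prolongation m N (f : R -> R) (Z : A) : A :=
  let x := scalar_part m Z in
  let H := Z - x%:A in
  \sum_(0 <= k < N.+1) ((k`!%:R)^-1 * f^`(k)%classic x) *: H ^+ k.

Lemma weil_prolongationE m N f (x : R) (H : A) :
  is_weil_algebra m N -> H \in m ->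
  weil_prolongation m N f (x%:A + H) =
  \sum_(0 <= k < N.+1) ((k`!%:R)^-1 * f^`(k)%classic x) *: H ^+ k.
Proof.
move=> wA Hm; rewrite /weil_prolongation /=.
by rewrite (scalar_partD _ wA Hm) addrC addKr.
Qed.

End WeilAlgebra.

(* The underlying real vector space of A, without its ring structure, normed
   by the sup norm of coordinates in the reference basis.  All norms being
   equivalent in finite dimension, the topology and the differential calculus
   do not depend on this choice.  It is an alias because a ring with a norm is
   a numDomainType in the hierarchy. *)
Definition real_space (R : realType) (A : comFalgType R) : Type := A.

Section RealSpace.
Context {R : realType} {A : comFalgType R}.
Local Notation V := (real_space A).

HB.instance Definition _ := GRing.Lmodule.copy V A.

Definition real_norm (x : V) : R := `|v2r (x : A)|.

Lemma real_normD (x y : V) : real_norm (x + y) <= real_norm x + real_norm y.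
Proof. by rewrite /real_norm [v2r _]linearD ler_normD. Qed.

Lemma real_normZ (a : R) (x : V) : real_norm (a *: x) = `|a| * real_norm x.
Proof. by rewrite /real_norm [v2r _]linearZ normrZ. Qed.

Lemma real_norm_eq0 (x : V) : real_norm x = 0 -> x = 0.
Proof.
move=> /normr0_eq0 x0; apply: (@v2r_inj R A).
by rewrite x0 [RHS](linear0 v2r).
Qed.

HB.instance Definition _ := Lmodule_isNormed.Build R V
  real_normD real_normZ real_norm_eq0.

End RealSpace.

(* C^r maps on an open set D (real sense).  As V is finite dimensional in all
   uses, the derivative x |-> 'd f x is C^r as a map into the space of linear
   maps iff x |-> 'd f x v is C^r for every v.  Maps are total functions, but
   for D open only their values on D matter. *)
Fixpoint Cr_on {R : realType} {V W : normedModType R} (r : nat)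
    (D : set V) (f : V -> W) : Prop :=
  match r with
  | 0 => forall x, D x -> {for x, continuous f}
  | r'.+1 => (forall x, D x -> differentiable f x) /\
             (forall v, Cr_on r' D (fun x => 'd f x v))
  end.

Section Holomorphic.
Context {R : realType} {A : comFalgType R}.
Implicit Types (D : set A) (F : A -> A).

Definition real_Cr (r : nat) D F : Prop :=
  @Cr_on R (real_space A) (real_space A) r D F.

Definition real_diff F (Z : A) : A -> A :=
  'd (F : real_space A -> real_space A) (Z : real_space A).

(* Additivity of the differential holds by construction, so A-linearity is
   compatibility with multiplication by elements of A. *)
Definition A_holomorphic D F : Prop :=
  real_Cr 1 D F /\
  forall Z, D Z -> forall a K : A, real_diff F Z (a * K) = a * real_diff F Z K.

End Holomorphic.

(* Main.v *)
(* Taylor's formula along H, without symmetry of second derivatives: if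
   a H^j = 0, then
     a F(x + t H) = \sum_(i < j) t^i / i! f^(i)(x) a H^i   for x in U, t real.
   This is proved by induction on j for all a at once.  The induction
   hypothesis for a H, differentiated along the real direction x, gives
   a H F'(x + t H), which by A-linearity of the differential is the
   t-derivative of a F(x + t H); it remains to integrate from t = 0.  The
   theorem is the case a = t = 1, j = N + 1.  Vector identities are tested
   against real linear functionals, so only scalar calculus is needed. *)
Require Import Defs.
From HB Require Import structures.
From mathcomp Require Import all_boot all_order all_algebra falgebra.
From mathcomp Require Import all_classical all_reals all_analysis.
From mathcomp Require Import ring.

Import Order.TTheory GRing.Theory Num.Theory.
Import VectorInternalTheory.
Import numFieldNormedType.Exports.
Local Open Scope classical_set_scope.
Local Open Scope ring_scope.

Set Implicit Arguments.
Unset Strict Implicit.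

(** * Continuity of linear functionals in finite dimension *)

Lemma norm_row_coord (R : realType) n (v : 'rV[R]_n) i : `|v ord0 i| <= `|v|.
Proof.
rewrite [`|v|]mx_normrE.
exact: (le_bigmax _ (fun ij : 'I_1 * 'I_n => `|v ij.1 ij.2|) (ord0, i)).
Qed.

(** Expanding [Z] in the reference basis [b], the sum of the [|l (b i)|] bounds [l], because the
    norm is the sup norm of the coordinates. *)
Lemma linear_real_space_continuous (R : realType) (A : comFalgType R)
  (l : {linear real_space A -> R}) : continuous l.
Proof.
apply/bounded_linear_continuous/linear_boundedP.
pose b i : A := r2v (delta_mx ord0 i).
have lE (Z : A) : l Z = \sum_i v2r Z ord0 i * l (b i).
  have {1}-> : Z = \sum_i v2r Z ord0 i *: b i.
    rewrite -{1}(v2rK Z) {1}(row_sum_delta (v2r Z)) (linear_sum r2v).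
    by apply: eq_bigr => i _; exact: linearZ_LR.
  by rewrite (linear_sum l); apply: eq_bigr => i _; exact: (linearZ_LR l).
near=> r => Z.
have le_r : \sum_i `|l (b i)| <= r.
  by near: r; apply: nbhs_pinfty_ge; exact: num_real.
rewrite lE (le_trans (ler_norm_sum _ _ _))// (le_trans _ (ler_wpM2r _ le_r))//.
rewrite mulr_suml ler_sum// => i _.
by rewrite normrM mulrC ler_wpM2l// norm_row_coord.
Unshelve. all: by end_near. Qed.

Lemma memv_expr (K : fieldType) (A : falgType K) (U : {vspace A}) (x : A) n :
  x \in U -> x ^+ n \in (U ^+ n)%VS.
Proof.
move=> Ux; elim: n => [|n IH]; first by rewrite expr0 expv0 memv_line.
by rewrite exprS expvSl memv_mul.
Qed.

(** * Reduction of vector calculus to scalar functions *)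

Section LinearFunctionals.
Context {R : realType} {A : comFalgType R}.
Local Notation V := (real_space A).

(** Chain rule for [l], [F] and an affine line. It is used with [K = 1] to move along the real
    direction and with [K = H] to move along [H]. *)
Lemma is_derive_line (l : {linear V -> R}) (F : A -> A) (P K : A) (t : R) :
  differentiable (F : V -> V) (P + t *: K : V) ->
  is_derive t 1 (fun s : R => l (F (P + s *: K)))
    (l (real_diff F (P + t *: K) K)).
Proof.
move=> dF.
have dline : is_diff t (cst (P : V) + *:%R^~ (K : V)) (0 + *:%R^~ (K : V)).
  exact: is_diffD.
have dFP : is_diff (P + t *: K : V) (F : V -> V) (real_diff F (P + t *: K)).
  exact: differentiableP.
have lc : continuous l by exact: linear_real_space_continuous.
have dl : is_diff (F (P + t *: K) : V) l l.
  by apply: DiffDef; [exact: linear_differentiable|rewrite diff_lin].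
have [dG GE] := is_diff_comp (is_diff_comp dline dFP) dl.
apply: DeriveDef; first exact/derivable1_diffP/dG.
by rewrite [LHS](deriveE _ dG) GE /= add0r scale1r.
Qed.

Lemma linear_functional_inj (Y Z : A) :
  (forall l : {linear V -> R}, l Y = l Z) -> Y = Z.
Proof.
move=> eqYZ; apply: (@v2r_inj R A); apply/rowP => i.
pose f (X : V) : R := v2r (X : A) ord0 i.
have linf : linear f by move=> c X1 X2; rewrite /f [v2r _]linearP !mxE.
pose l : {linear V -> R} :=
  HB.pack f (GRing.isLinear.Build R _ _ _ f linf).
exact: (eqYZ l).
Qed.

(** Absorbing the factor [a] into the functional lets [a * F] be differentiated without a product
    rule in [A]. *)
Lemma linear_functional_mull (l : {linear V -> R}) (a : A) :
  exists g : {linear V -> R}, forall Z, g Z = l (a * Z).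
Proof.
pose f (X : V) : R := l (a * (X : A)).
have linf : linear f.
  by move=> c X1 X2; rewrite /f mulrDr -scalerAr; exact: (linearP l).
pose g : {linear V -> R} :=
  HB.pack f (GRing.isLinear.Build R _ _ _ f linf).
by exists g.
Qed.

(** Such a functional recovers [f] from [F]: on the real axis [l (F x%:A)] is [l 1] times [f x], and
    [l 1] can be divided out. *)
Lemma linear_functional1_neq0 : exists l : {linear V -> R}, l (1 : A) != 0.
Proof.
apply/not_existsP => l1; have /eqP := oner_neq0 A; apply.
apply: linear_functional_inj => l.
by have /negP/negPn/eqP -> := l1 l; rewrite (linear0 l).
Qed.

End LinearFunctionals.

(** * Regularity of the scalar restriction *)

Section RealAxis.
Context {R : realType} {A : comFalgType R} {U : set R} {D : set A}
  (Uo : open U) (UD : forall x, U x -> D x%:A).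
Local Notation V := (real_space A).

Lemma near_real_axis (F : A -> A) (f : R -> R) (l : {linear V -> R}) x :
  U x ->
  (forall x, U x -> F x%:A = (f x)%:A :> A) ->
  \near x, l (F x%:A) = l (1 : A) *: f x.
Proof.
move=> Ux Ff; near=> y; rewrite Ff; first by rewrite linearZ_LR; exact: mulrC.
near: y; exact: open_nbhs_nbhs.
Unshelve. all: by end_near. Qed.

(** A functional with [l 1 != 0] gives derivability of [f]; testing against all functionals then
    identifies the differential. *)
Lemma real_axis_derive1 (F : A -> A) (f : R -> R) x : U x ->
  (forall x, U x -> F x%:A = (f x)%:A :> A) ->
  differentiable (F : V -> V) (x%:A : V) ->
  derivable f x 1 /\ real_diff F x%:A 1 = (f^`()%classic x)%:A.
Proof.
move=> Ux Ff dF.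
have dl (l : {linear V -> R}) :
    is_derive x 1 (l (1 : A) \*: f) (l (real_diff F x%:A 1)).
  apply: near_eq_is_derive (near_real_axis l Ux Ff) _.
  have := is_derive_line l (F := F) (P := 0) (K := 1) (t := x).
  under [X in is_derive _ _ X]eq_fun do rewrite add0r.
  by rewrite add0r; apply.
have df : derivable f x 1.
  have [l l1] := @linear_functional1_neq0 R A.
  have := is_deriveZ (l (1 : A))^-1 (dl l).
  rewrite (_ : _ \*: _ = f); first by case.
  by apply/funext => y /=; rewrite scalerA mulVf// scale1r.
split => //; apply: (@linear_functional_inj R A) => l.
have dlf := is_deriveZ (l (1 : A)) (derivableP df).
rewrite -(@derive_val _ _ _ _ _ _ _ (dl l)) (@derive_val _ _ _ _ _ _ _ dlf).
by rewrite derive1E linearZ_LR; exact: mulrC.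
Qed.

(** Induction over all pairs [F], [f]: the map sending [Z] to ['d F Z v%:A] is again scalar-valued
    on the real axis, with restriction ['d f x v]. *)
Lemma real_axis_Cr r (F : A -> A) (f : R -> R) : real_Cr r D F ->
  (forall x, U x -> F x%:A = (f x)%:A) -> Cr_on r U f.
Proof.
elim: r F f => [|r IH] F f /=.
  move=> cF Ff x Ux; have [l l1] := @linear_functional1_neq0 R A.
  have lF : l (F y%:A) @[y --> x] --> l (F x%:A).
    have c1 : (fun y => y%:A : V) @ x --> (x%:A : V).
      exact: (@scalel_continuous _ _ (1 : V)).
    have c2 : (F : V -> V) @ (x%:A : V) --> (F x%:A : V).
      exact/cF/UD.
    have c3 : l @ (F x%:A : V) --> l (F x%:A).
      exact: linear_real_space_continuous.
    exact: (cvg_comp _ _ c1 (cvg_comp _ _ c2 c3)).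
  have : l (1 : A) *: f y @[y --> x] --> l (1 : A) *: f x.
    rewrite -(nbhs_singleton (near_real_axis l Ux Ff)).
    exact: cvg_trans (near_eq_cvg (near_real_axis l Ux Ff)) lF.
  move=> h; have {h} := cvgZl_tmp (k := (l (1 : A))^-1) h.
  rewrite scalerA mulVf// scale1r (_ : _ \*: _ = f); first exact.
  by apply/funext => y /=; rewrite scalerA mulVf// scale1r.
case=> dF CF Ff; split=> [x Ux|v].
  apply/derivable1_diffP.
  by have [] := real_axis_derive1 Ux Ff (dF _ (UD Ux)).
apply: (IH _ _ (CF v%:A)) => x Ux.
have [df dFE] := real_axis_derive1 Ux Ff (dF _ (UD Ux)).
have -> : 'd f x v = v * f^`()%classic x.
  rewrite derive1E'; last exact/derivable1_diffP.
  by rewrite -[v in LHS]mulr1; exact: linearZ_LR.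
by rewrite -scalerA -dFE; exact: linearZ_LR.
Qed.

(** Induction on [k], replacing [F] by its differential in the direction [1], whose restriction is
    the derivative of [f]. *)
Lemma real_axis_derivable r (F : A -> A) (f : R -> R) x k : real_Cr r D F ->
  (forall x, U x -> F x%:A = (f x)%:A) -> (k < r)%N -> U x ->
  derivable f^`(k)%classic x 1.
Proof.
elim: k r F f => [|k IH] [|r] F f // [dF CF] Ff kr Ux.
  by rewrite derive1n0; have [] := real_axis_derive1 Ux Ff (dF _ (UD Ux)).
rewrite derive1Sn; apply: (IH _ _ _ (CF 1)) => // y Uy.
by have [_ <-] := real_axis_derive1 Uy Ff (dF _ (UD Uy)).
Qed.

End RealAxis.

(** * Taylor expansion along a direction [H] *)

Lemma is_derive_taylor_sum (R : realType) (c : nat -> R) j (t : R) :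
  is_derive t 1 (fun s : R => \sum_(i < j.+1) s ^+ i / i`!%:R * c i)
    (\sum_(i < j) t ^+ i / i`!%:R * c i.+1).
Proof.
(* As a linear combination of powers of the identity, the sum has a derivative that instance
   inference can find. *)
have -> : (fun s : R => \sum_(i < j.+1) s ^+ i / i`!%:R * c i) =
    \sum_(i < j.+1) ((c i / i`!%:R) \*: (@id R : R -> R) ^+ i).
  apply/funext => s; rewrite fct_sumE; apply: eq_bigr => i _.
  by rewrite /= exprfctE mulrAC -mulrA; exact: mulrC.
apply: is_derive_eq.
rewrite big_ord_recl mul0r scale0r scaler0 add0r; apply: eq_bigr => i _ /=.
rewrite /bump/= add1n add0n factS natrM -[_ *: _]/(_ * (_ * 1)).
by field; rewrite nat1r !pnatr_eq0 -!lt0n fact_gt0.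
Qed.

(** The bound [k.+1 < j] fits the induction: the formula of length [j - 1] is differentiated in [x],
    which involves derivatives of [f] up to order [j - 1] only. *)
Lemma mul_holomorphic_taylor (R : realType) (A : comFalgType R) (U : set R)
    (D : set A) (F : A -> A) (f : R -> R) (H : A) j (a : A) :
  open U -> (forall x t, U x -> D (x%:A + t *: H)) ->
  A_holomorphic D F ->
  (forall x, U x -> F x%:A = (f x)%:A) ->
  (forall x k, U x -> (k.+1 < j)%N -> derivable f^`(k)%classic x 1) ->
  a * H ^+ j = 0 ->
  forall x t, U x ->
  a * F (x%:A + t *: H) =
  \sum_(i < j) (t ^+ i / i`!%:R * f^`(i)%classic x) *: (a * H ^+ i).
Proof.
move=> Uo UD [[dF _] holF] Ff; elim: j a => [|j IH] a.
  (* For [j = 0] the hypothesis reads [a = 0]. *)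
  by move=> _ + x t _; rewrite expr0 mulr1 big_ord0 => ->; rewrite mul0r.
move=> df aH x t Ux.
have {}IH y s : U y -> a * H * F (y%:A + s *: H) =
    \sum_(i < j) (s ^+ i / i`!%:R * f^`(i)%classic y) *: (a * H ^+ i.+1).
  move=> Uy; rewrite (IH (a * H)) -?mulrA -?exprS//.
    by apply: eq_bigr => i _; rewrite -[a * H * _]mulrA -exprS.
  by move=> z k Uz kj; apply: df => //; exact: ltnW.
(* The derivative of [IH] in [y]; since [U] is open, [IH] holds near [y], which suffices. *)
have IH' y s : U y -> a * H * real_diff F (y%:A + s *: H) 1 =
    \sum_(i < j) (s ^+ i / i`!%:R * f^`(i.+1)%classic y) *: (a * H ^+ i.+1).
  move=> Uy; apply: (@linear_functional_inj R A) => l.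
  have [g gE] := linear_functional_mull l (a * H).
  have dg : is_derive y 1 (fun u => g (F (u%:A + s *: H)))
      (g (real_diff F (y%:A + s *: H) 1)).
    have := is_derive_line g (F := F) (P := s *: H) (K := 1) (t := y).
    under [X in is_derive _ _ X]eq_fun do rewrite addrC.
    by rewrite addrC; apply; exact/dF/UD.
  pose c (i : 'I_j) := s ^+ i / i`!%:R * l (a * H ^+ i.+1).
  have dsum : is_derive y 1 (\sum_(i < j) (c i \*: f^`(i)%classic))
      (\sum_(i < j) c i *: f^`(i.+1)%classic y).
    apply: is_derive_sum => i; apply: is_deriveZ.
    by rewrite derive1nS derive1E; apply/derivableP/df => //; exact: ltn_ord.
  have gsum : \near y,
      g (F (y%:A + s *: H)) = (\sum_(i < j) (c i \*: f^`(i)%classic)) y.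
    near=> u; rewrite gE IH.
      rewrite (linear_sum l) fct_sumE; apply: eq_bigr => i _.
      by rewrite linearZ_LR; exact: mulrAC.
    by near: u; exact: open_nbhs_nbhs.
  rewrite -gE -(@derive_val _ _ _ _ _ _ _ (near_eq_is_derive gsum dg)).
  rewrite (@derive_val _ _ _ _ _ _ _ dsum) (linear_sum l).
  by apply: eq_bigr => i _; rewrite linearZ_LR; exact: mulrAC.
apply: (@linear_functional_inj R A) => l.
have [g gE] := linear_functional_mull l a.
pose c i := f^`(i)%classic x * l (a * H ^+ i).
have <- : \sum_(i < j.+1) t ^+ i / i`!%:R * c i =
    l (\sum_(i < j.+1) (t ^+ i / i`!%:R * f^`(i)%classic x) *: (a * H ^+ i)).
  rewrite linear_sum; apply: eq_bigr => i _.
  by rewrite /c mulrA; apply/esym/linearZ_LR.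
have dg (s : R) : is_derive s 1 (fun s => g (F (x%:A + s *: H)))
    (\sum_(i < j) s ^+ i / i`!%:R * c i.+1).
  apply: is_derive_eq; first exact/is_derive_line/dF/UD.
  (* Writing [H] as [H * 1], [A]-linearity turns the differential along [H] into [H] times the one
     along [1], to which [IH'] applies. *)
  rewrite gE -[X in real_diff _ _ X]mulr1 holF ?mulrA ?IH'//; last exact: UD.
  rewrite (linear_sum l); apply: eq_bigr => i _.
  by rewrite /c mulrA; apply/linearZ_LR.
pose p (s : R) := \sum_(i < j.+1) s ^+ i / i`!%:R * c i.
have d0 (s : R) : is_derive s 1 ((fun s => g (F (x%:A + s *: H))) - p) 0.
  apply: is_derive_eq; first exact: is_deriveB (is_derive_taylor_sum c j s).
  exact: subrr.
(* The whole line through [x] in direction [H] lies in [D], so the derivative vanishes for every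
   real [s] and the difference is constant. *)
have : g (F (x%:A + t *: H)) - p t = g (F (x%:A + 0 *: H)) - p 0.
  exact: is_derive_0_is_cst t 0 d0.
rewrite scale0r addr0 Ff// !gE (_ : p 0 = l (a * (f x)%:A)).
  by rewrite subrr => /eqP; rewrite subr_eq0 => /eqP.
(* At [0] only the term [i = 0] of [p] survives, since [0 ^+ 0 = 1]. *)
rewrite /p big_ord_recl big1 => [|i _]; last by rewrite expr0n/= mul0r mul0r.
rewrite expr0 fact0 divr1 mul1r addr0 /c derive1n0 expr0 mulr1 -scalerAr mulr1.
by apply/esym/linearZ_LR.
Unshelve. all: by end_near. Qed.

(** * The prolongation formula and uniqueness on Weil domains *)

Unset Implicit Arguments.

Theorem theorem3p3 (R : realType) (A : comFalgType R)
    (m : {vspace A}) (N : nat) (U : set R) :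
  is_weil_algebra m N -> open U -> is_interval U ->
  (forall (F : A -> A) (f : R -> R),
     real_Cr N.+1 (weil_domain m U) F ->
     A_holomorphic (weil_domain m U) F ->
     (forall x, U x -> F x%:A = (f x)%:A) ->
     Cr_on N.+1 U f /\
     (forall x H, U x -> H \in m ->
        F (x%:A + H) = \sum_(0 <= k < N.+1) (f^`(k)%classic x / k`!%:R) *: H ^+ k /\
        \sum_(0 <= k < N.+1) (f^`(k)%classic x / k`!%:R) *: H ^+ k
          = weil_prolongation m N f (x%:A + H))) /\
  (forall (F G : A -> A) (f : R -> R),
     real_Cr N.+1 (weil_domain m U) F ->
     A_holomorphic (weil_domain m U) F ->
     real_Cr N.+1 (weil_domain m U) G ->
     A_holomorphic (weil_domain m U) G ->
     (forall x, U x -> F x%:A = (f x)%:A) ->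
     (forall x, U x -> G x%:A = (f x)%:A) ->
     forall Z, weil_domain m U Z -> F Z = G Z).
Proof.
move=> wA Uo _.
have UD x H : U x -> H \in m -> weil_domain m U (x%:A + H).
  by move=> Ux Hm; rewrite /weil_domain /= (scalar_partD x wA Hm).
have UD0 x : U x -> weil_domain m U x%:A.
  by move=> Ux; rewrite -[x%:A]addr0; apply: UD => //; exact: mem0v.
have taylor (F : A -> A) (f : R -> R) : real_Cr N.+1 (weil_domain m U) F ->
    A_holomorphic (weil_domain m U) F -> (forall x, U x -> F x%:A = (f x)%:A) ->
    forall x H, U x -> H \in m ->
      F (x%:A + H) = \sum_(0 <= k < N.+1) (f^`(k)%classic x / k`!%:R) *: H ^+ k.
  move=> CF holF Ff x H Ux Hm.
  have HN : 1 * H ^+ N.+1 = 0.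
    by apply/eqP; rewrite mul1r -memv0 -(weil_nilpotent wA) memv_expr.
  have := mul_holomorphic_taylor Uo _ holF Ff _ HN 1 Ux.
  rewrite mul1r scale1r big_mkord => ->.
  - by apply: eq_bigr => i _; rewrite expr1n mul1r mul1r mulrC.
  (* Multiples of [H] stay in [m], so the line in direction [H] never leaves the domain. *)
  - by move=> y t Uy; apply: UD => //; exact: memvZ.
  - move=> y k Uy kN; apply: (real_axis_derivable Uo UD0 CF Ff) => //.
    exact: ltnW.
split=> [F f CF holF Ff|F G f CF holF CG holG Ff Gf Z].
  split; first exact: (real_axis_Cr Uo UD0 CF Ff).
  move=> x H Ux Hm; split; first exact: taylor.
  rewrite (weil_prolongationE f x wA Hm).
  by apply: eq_bigr => k _; rewrite mulrC.
(* Every point of the domain is some [x%:A + H], where both maps equal the same sum, determined by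
   [f]. *)
rewrite (weil_domainE U wA) => -[x Ux [H Hm ->]].
by rewrite (taylor F f)// (taylor G f).
Qed.
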